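(* There are families $(X_\alpha,Y_\alpha,A_\alpha,B_\alpha\mid\alpha<\omega_1)$ of subsets of $\mathbb{N}$ such that: (1) $X_\alpha=A_\alpha\cup B_\alpha$ is infinite and $A_\alpha\cap B_\alpha=\emptyset$ for all $\alpha<\omega_1$; (2) $X_\beta\cap X_\alpha$ is finite for all $\beta<\alpha<\omega_1$; (3) $Y_\beta\subseteq^* Y_\alpha$ for all $\beta<\alpha<\omega_1$; (4) $X_\beta\subseteq^* Y_\alpha$ for all $\beta<\alpha<\omega_1$; (5) $X_\alpha\cap Y_\alpha=\emptyset$ for all $\alpha<\omega_1$; (6) for every $\alpha<\omega_1$ and every $k\in\mathbb{N}$, for all but finitely many $\beta<\alpha$ there is $l>k$ with $l\in A_\beta\cap B_\alpha$.
   Context: $A\subseteq^* B$ means that $A\setminus B$ is finite. *)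

(* Defs.v *)
From HB Require Import structures.
From mathcomp Require Import all_boot all_order.
From mathcomp Require Import boolp classical_sets functions cardinality wochoice.

Set Implicit Arguments.
Unset Strict Implicit.
Unset Printing Implicit Defensive.

Import Order.TTheory.
Local Open Scope classical_set_scope.

Definition almost_subset (A B : set nat) : Prop := finite_set (A `\` B).

Notation "A `<=*` B" := (almost_subset A B)
  (at level 70, no associativity) : classical_set_scope.

Definition wo_carrier : Type := set nat.

HB.instance Definition _ := Choice.on wo_carrier.

Definition wo_le : rel wo_carrier := sval (well_ordering_principle wo_carrier).

Lemma wo_le_wo : well_order wo_le.
Proof. exact: (svalP (well_ordering_principle wo_carrier)). Qed.

Fact wo_le_chain : wo_chain wo_le predT.
Proof. exact: withinW wo_le_wo. Qed.

Fact wo_le_refl : reflexive wo_le.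
Proof. by move=> x; apply: (wo_chain_reflexive wo_le_chain). Qed.

Fact wo_le_anti : antisymmetric wo_le.
Proof. by move=> x y; apply: (wo_chain_antisymmetric wo_le_chain). Qed.

Fact wo_le_total : total wo_le.
Proof. by move=> x y; apply: (wo_chainW wo_le_chain). Qed.

Fact wo_le_trans : transitive wo_le.
Proof.
move=> y x z xy yz.
have [|m [[/or3P mA mlb] _]] := @wo_le_wo (fun t => [|| t == x, t == y | t == z]).
  by exists x; rewrite unfold_in eqxx.
have mx : wo_le m x by apply: mlb; rewrite unfold_in eqxx.
have my : wo_le m y by apply: mlb; rewrite unfold_in eqxx orbT.
have mz : wo_le m z by apply: mlb; rewrite unfold_in eqxx !orbT.
case: mA => /eqP mE; subst m => //.
  by rewrite (@wo_le_anti x y) // xy mx.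
by rewrite (@wo_le_anti z y) ?yz ?my // in xy *.
Qed.

Fact wo_display : Order.disp_t. Proof. exact: Order.Disp tt tt. Qed.

HB.instance Definition _ := Order.Le_isPOrder.Build wo_display wo_carrier
  wo_le_refl wo_le_anti wo_le_trans.
HB.instance Definition _ := Order.POrder_isTotal.Build wo_display wo_carrier
  wo_le_total.

(* The points of a well-ordered uncountable set that have only countably many
   predecessors form an initial segment of order type omega_1; this is the
   content of [omega1_well_order], [omega1_uncountable] and
   [omega1_countable_lt], which determine the order up to isomorphism. *)
Definition omega1 : Type :=
  {x : wo_carrier | countable [set y : wo_carrier | (y < x)%O]}.

HB.instance Definition _ := SubChoice.on omega1.

Fact omega1_display : Order.disp_t. Proof. exact: Order.Disp tt tt. Qed.

HB.instance Definition _ :=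
  [SubChoice_isSubOrder of omega1 by <: with omega1_display].

Lemma omega1_well_order : well_order (<=%O : rel omega1).
Proof.
apply: antisymmetric_well_order => [|A [a Aa]]; first exact: le_anti.
have [|m [[mA mlb] _]] :=
    @wo_le_wo (fun x : wo_carrier => `[< exists2 b, b \in A & val b = x >]).
  by exists (val a); rewrite unfold_in; apply/asboolP; exists a.
move: mA; rewrite unfold_in => /asboolP[b Ab bm].
exists b; split=> // c Ac.
have : wo_le m (val c) by apply: mlb; rewrite unfold_in; apply/asboolP; exists c.
by rewrite -bm.
Qed.

Lemma omega1_countable_lt (a : omega1) : countable [set b : omega1 | (b < a)%O].
Proof.
apply: sub_countable (valP a).
rewrite -(card_le_eql (inj_card_eq (in2W val_inj))).
by apply: subset_card_le => _ [b ba <-].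
Qed.

Lemma wo_carrier_uncountable : ~ countable [set: wo_carrier].
Proof.
move=> /countable_injP[f finj].
pose D : set nat := [set n | exists2 A : wo_carrier, f A = n & ~ A n].
have [DD|nDD] := pselect (D (f D)); last by apply: (nDD); exists D.
by have [A fA] := DD; rewrite -fA (finj A D) ?inE // => nA; apply: nA; rewrite fA.
Qed.

Lemma omega1_uncountable : ~ countable [set: omega1].
Proof.
move=> cW.
have cI : countable [set x : wo_carrier | countable [set y | (y < x)%O]].
  apply: sub_countable cW.
  rewrite -(card_le_eqr (inj_card_eq (in2W val_inj))).
  by apply: subset_card_le => x cx; exists (exist _ x cx).
have [x ncx] : exists x : wo_carrier, ~~ countable [set y | (y < x)%O].
  apply: contrapT => nx; apply: wo_carrier_uncountable.
  apply: sub_countable cI; apply: subset_card_le => x _ /=.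
  by apply: contrapT => /negP ncx; apply: nx; exists x.
have [|m [[mA mlb] _]] :=
    @wo_le_wo (fun x : wo_carrier => ~~ countable [set y | (y < x)%O]).
  by exists x.
move: mA; rewrite unfold_in => /negP; apply.
apply: sub_countable cI; apply: subset_card_le => y /= ym.
apply: contrapT => /negP ncy.
have : (m <= y)%O by apply: mlb; rewrite unfold_in.
by rewrite leNgt ym.
Qed.

(* Main.v *)
Require Import Defs.
From mathcomp Require Import all_boot all_order.
From mathcomp Require Import finmap.
From mathcomp Require Import boolp classical_sets functions cardinality.

Local Open Scope classical_set_scope.
Import Order.TTheory.

(** Put Z_a := N \ (X_a ∪ Y_a): the theorem asks for a ⊆*-decreasing sequence
    Z_a, with X_a = A_a ∪ B_a disjoint from Z_a and almost contained in Z_b for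
    b < a. To meet (6) at stage a, B_a must pick a point from A_b for almost all
    b < a, although A_b ∩ Z_c is finite for b <= c < a. So the recursion
    maintains that for every c and k, almost all b < c satisfy
    |A_b ∩ Z_c| >= k, and even that at least k of these points lie in column
    e_c(b) of N, for a partition of N into columns and a coherent sequence of
    injections e_c : c -> N. Coherence makes this hypothesis independent of c
    up to finitely many b, and injectivity makes the points owned by distinct b
    disjoint. At stage a, let W_j be the intersection of the Z_c with
    e_a(c) < j. Each b < a contributes a finite set of points of A_b, in its
    column and in W_j(b), with j(b) its cardinality and j(b) -> oo; one point of
    it goes to B_a, the others to Z_a. *)

(** * Finite sets of naturals; induction and recursion along [omega1] *)

Lemma finite_nat_bounded (S : set nat) :
  finite_set S -> exists m, forall x, S x -> (x < m)%N.
Proof.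
move=> /finite_seqP[s ->]; exists (\max_(x <- s) x).+1 => x xs.
by rewrite ltnS; apply: leq_bigmax_seq.
Qed.

Lemma infinite_natP (S : set nat) :
  infinite_set S <-> forall i, exists2 x, S x & (i < x)%N.
Proof.
split=> [Soo i|Sub /finite_nat_bounded[m Sm]].
  apply: contrapT => nS; apply: Soo.
  apply: sub_finite_set (finite_II i.+1) => x Sx.
  by rewrite /= ltnS leqNgt; apply/negP => ix; apply: nS; exists x.
by have [x /Sm xm] := Sub m; rewrite ltnNge (ltnW xm).
Qed.

Lemma omega1_ind (Q : omega1 -> Prop) :
  (forall a, (forall b, (b < a)%O -> Q b) -> Q a) -> forall a, Q a.
Proof.
move=> Qind a; apply: contrapT => nQa.
have [|m [[mA mlb] _]] := @omega1_well_order (fun x => ~~ `[< Q x >]).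
  by exists a; rewrite unfold_in; apply/negP => /asboolP.
move: mA; rewrite unfold_in => /negP; apply; apply/asboolP.
apply: Qind => b bm; apply: contrapT => nQb.
have : (m <= b)%O by apply: mlb; rewrite unfold_in; apply/negP => /asboolP.
by rewrite leNgt bm.
Qed.

(** [Fix] runs with a function [c] that returns a solution whenever one exists. That one exists at
    each stage is shown only afterwards, by induction. The first hypothesis allows [f] to be
    exchanged for [ext], which agrees with it below [a] and has the default value [s0] elsewhere. *)
Lemma omega1_rec {S : Type} (s0 : S)
    (R : omega1 -> (omega1 -> S) -> S -> Prop) :
  (forall (a : omega1) f g s, (forall b : omega1, (b < a)%O -> f b = g b) ->
    R a f s -> R a g s) ->
  (forall (a : omega1) f, (forall b : omega1, (b < a)%O -> R b f (f b)) ->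
    exists s, R a f s) ->
  exists f, forall a, R a f (f a).
Proof.
move=> Rext Rex.
have wf : well_founded (fun b a : omega1 => (b < a)%O).
  by move=> a; elim/omega1_ind: a => a IH; constructor.
pose ext (a : omega1) (rec : forall b : omega1, (b < a)%O -> S) (b : omega1) :=
  if pselect (b < a)%O is left ba then rec b ba else s0.
have [c cP] : {c : omega1 * (omega1 -> S) -> S &
    forall p, (exists s, R p.1 p.2 s) -> R p.1 p.2 (c p)}.
  apply: (@choice _ _ (fun p s => (exists s', R p.1 p.2 s') -> R p.1 p.2 s)) => p.
  have [[s Rs]|nR] := pselect (exists s, R p.1 p.2 s).
    by exists s.
  by exists s0.
pose f := Fix wf (fun _ => S) (fun a rec => c (a, ext a rec)).
have fE a : f a = c (a, ext a (fun b _ => f b)).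
  rewrite /f Fix_eq // => x g h gh; congr (c (x, _)).
  by apply/funext => b; rewrite /ext; case: pselect.
exists f => a; elim/omega1_ind: a => a IH.
have [s Rs] := Rex a f IH.
have fext (b : omega1) : (b < a)%O -> f b = ext a (fun b _ => f b) b.
  by rewrite /ext; case: pselect.
rewrite fE; apply: (Rext a (ext a (fun b _ => f b))).
  by move=> b /fext ->.
by apply: (cP (a, _)) => /=; exists s; apply: Rext Rs.
Qed.

(** * Coherent sequences of functions into N *)

Lemma finite_preimage_in {T} (D : set T) (f : T -> nat) (B : set nat) :
  {in D &, injective f} -> finite_set B -> finite_set (D `&` f @^-1` B).
Proof.
move=> finj Bfin.
have injDB : {in D `&` f @^-1` B &, injective f}.
  by move=> x y; rewrite !inE => -[Dx _] [Dy _]; apply: finj; rewrite inE.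
rewrite -(eq_finite_set (inj_card_eq injDB)).
by apply: sub_finite_set Bfin => _ [x [_ Bx] <-].
Qed.

(** Finite-to-one functions suit the recursion better than injections: raising values keeps fibres
    finite but may destroy injectivity. *)
Lemma coherent_finite_to_one : exists e : omega1 -> omega1 -> nat,
  (forall a n, finite_set [set b : omega1 | (b < a)%O /\ (e a b <= n)%N]) /\
  (forall a c, (c < a)%O ->
    finite_set [set b : omega1 | (b < c)%O /\ e c b <> e a b]).
Proof.
pose R a (f : omega1 -> omega1 -> nat) (g : omega1 -> nat) :=
  (forall n, finite_set [set b : omega1 | (b < a)%O /\ (g b <= n)%N]) /\
  (forall c, (c < a)%O -> finite_set [set b : omega1 | (b < c)%O /\ f c b <> g b]).
have [|a f IH|e eR] := @omega1_rec _ (fun=> 0%N) R.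
- move=> a f g s fg [sfin scoh]; split=> // c ca.
  by rewrite -(fg c ca); apply: scoh.
- have /countable_injP[i iinj] := omega1_countable_lt a.
  have ifin n : finite_set [set c : omega1 | (c < a)%O /\ (i c <= n)%N].
    exact: finite_preimage_in iinj (finite_II n.+1).
  (* [r b] is the [c] in [[b, a)] that comes first in the enumeration [i]; the
     new function is [f (r b) b], raised to [i (r b)] to be finite-to-one. *)
  have [r rP] : {r : omega1 -> omega1 & forall b, (b < a)%O ->
      [/\ (b <= r b)%O, (r b < a)%O &
          forall c, (b <= c)%O -> (c < a)%O -> (i (r b) <= i c)%N]}.
    apply: (@choice _ _ (fun b r => (b < a)%O -> [/\ (b <= r)%O, (r < a)%O &
      forall c, (b <= c)%O -> (c < a)%O -> (i r <= i c)%N])) => b.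
    have [ba|nba] := pselect (b < a)%O; last by exists b.
    pose Q n := `[< exists2 c, (b <= c < a)%O & i c = n >].
    have Qex : exists n, Q n by exists (i b); apply/asboolP; exists b; rewrite ?lexx.
    case: (ex_minnP Qex) => n /asboolP[c /andP[bc ca] <-] cmin.
    exists c => _; split=> // d bd da; apply: cmin.
    by apply/asboolP; exists d; rewrite ?bd.
  have ffin c n : (c < a)%O -> finite_set [set b : omega1 | (b <= c)%O /\ (f c b <= n)%N].
    move=> ca; have [/(_ n) cfin _] := IH c ca.
    apply: (@sub_finite_set _ _ ([set c] `|` [set b : omega1 | (b < c)%O /\ (f c b <= n)%N])).
      by move=> b [] /=; rewrite le_eqVlt => /orP[/eqP ->|bc] fn; [left|right].
    by rewrite finite_setU.
  have fcoh c d : (c < a)%O -> (d < a)%O ->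
      finite_set [set b : omega1 | [/\ (b <= c)%O, (b < d)%O & f c b <> f d b]].
    move=> ca da; have [cd|dc|->] := ltgtP c d.
    - apply: (@sub_finite_set _ _ ([set c] `|` [set b : omega1 | (b < c)%O /\ f c b <> f d b])).
        by move=> b [] /=; rewrite le_eqVlt => /orP[/eqP ->|bc] fn; [left|right].
      by rewrite finite_setU; split=> //; apply: (IH d da).2.
    - apply: sub_finite_set ((IH c ca).2 d dc) => b [_ bd ne]; split=> //.
      exact: nesym.
    - by apply: (@sub_finite_set _ _ set0) => // b [].
  exists (fun b => maxn (i (r b)) (f (r b) b)); split=> [n|d da].
    apply: (@sub_finite_set _ _ (\bigcup_(c in [set c : omega1 | (c < a)%O /\ (i c <= n)%N])
      [set b : omega1 | (b <= c)%O /\ (f c b <= n)%N])).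
      move=> b [ba]; rewrite geq_max => /andP[irn frn].
      by have [brb rba _] := rP b ba; exists (r b).
    by apply: bigcup_finite => // c [ca _]; apply: ffin.
  (* For [b < d], the point [d] competes with [r b], so [i (r b) <= i d] and [r b] takes finitely
     many values [c]. For each of them, both the raising and the disagreement of [f c] with [f d]
     concern finitely many [b]. *)
  apply: (@sub_finite_set _ _
    (\bigcup_(c in [set c : omega1 | (c < a)%O /\ (i c <= i d)%N])
      ([set b : omega1 | (b <= c)%O /\ (f c b <= i c)%N] `|`
       [set b : omega1 | [/\ (b <= c)%O, (b < d)%O & f c b <> f d b]]))).
    move=> b [bd ne]; have [brb rba rmin] := rP b (lt_trans bd da).
    exists (r b); first by split=> //; apply: rmin => //; apply: ltW.
    have [fi|fi] := leqP (f (r b) b) (i (r b)); [by left|right; split=> //].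
    by move: ne; rewrite (maxn_idPr (ltnW fi)) => /nesym.
  apply: bigcup_finite => // c [ca _].
  by rewrite finite_setU; split; [apply: ffin|apply: fcoh].
- by exists e; split=> a; have [] := eR a.
Qed.

(* Pairing [e a b] with the rank of [b] in its fibre gives an injection. Two
   functions that differ at finitely many points have the same fibres over all
   but finitely many values, so coherence survives. *)
Lemma coherent_injective : exists e : omega1 -> omega1 -> nat,
  (forall a, {in [set b : omega1 | (b < a)%O] &, injective (e a)}) /\
  (forall a c, (c < a)%O ->
    finite_set [set b : omega1 | (b < c)%O /\ e c b <> e a b]).
Proof.
have [e [efin ecoh]] := coherent_finite_to_one.
pose F (a b : omega1) := [set x : omega1 | (x < b)%O /\ e a x = e a b].
have Ffin a b : (b < a)%O -> finite_set (F a b).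
  move=> ba; apply: sub_finite_set (efin a (e a b)) => x [xb ex].
  by split; [apply: lt_trans ba|rewrite ex].
exists (fun a b => choice.pickle (e a b, #|` fset_set (F a b)|)); split=> a.
  have wlog_lt (b c : omega1) : (b < c)%O -> (c < a)%O ->
      choice.pickle (e a b, #|` fset_set (F a b)|) <>
      choice.pickle (e a c, #|` fset_set (F a c)|).
    move=> bc ca /(pcan_inj choice.pickleK)[ebc]; apply/eqP; rewrite ltn_eqF//.
    have ba := lt_trans bc ca.
    apply: fproper_ltn_card; rewrite fproperEneq; apply/andP; split.
      apply/eqP => /fset_set_inj FF.
      have : F a c b by split.
      by rewrite -FF; [case; rewrite ltxx|exact: Ffin|exact: Ffin].
    rewrite -fset_set_sub; [|exact: Ffin|exact: Ffin].
    by move=> x [xb ex]; split; [apply: lt_trans bc|rewrite ex].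
  move=> b c; rewrite !inE /= => ba ca ebc.
  by have [bc|cb|//] := ltgtP b c; [case: (wlog_lt b c)|case: (wlog_lt c b)].
move=> c ca.
pose D := [set b : omega1 | (b < c)%O /\ e c b <> e a b].
have Dfin : finite_set D := ecoh a c ca.
have [m mP] : exists m, forall n, ((e c @` D) `|` (e a @` D)) n -> (n < m)%N.
  by apply: finite_nat_bounded; rewrite finite_setU; split; apply: finite_image.
apply: sub_finite_set (efin c m) => b [bc ne]; split=> //=.
rewrite leqNgt; apply/negP => mlt; apply: ne.
have agree x : (x < c)%O -> (m <= e c x)%N \/ (m <= e a x)%N -> e c x = e a x.
  move=> xc mle; apply: contrapT => ne.
  by case: mle; rewrite leqNgt mP //; [left|right]; exists x.
have eb : e c b = e a b by apply: agree => //; left; apply: ltnW.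
rewrite -eb; congr (choice.pickle (_, #|` fset_set _|)).
apply/seteqP; split=> x [xb ex]; split=> //.
  rewrite /= -eb -ex; apply/esym/agree; first exact: lt_trans bc.
  by left; rewrite ex ltnW.
rewrite /= eb -ex; apply: agree; first exact: lt_trans bc.
by right; rewrite ex -eb ltnW.
Qed.

(** * Large sets, almost inclusion and cells *)

Definition at_least {T : eqType} (k : nat) (S : set T) : Prop :=
  exists s : seq T, [/\ uniq s, (k <= size s)%N & [set` s] `<=` S].

Lemma at_least_sub {T : eqType} k (S S' : set T) :
  S `<=` S' -> at_least k S -> at_least k S'.
Proof. by move=> SS' [s [su sk sS]]; exists s; split=> // x /sS /SS'. Qed.

Lemma infinite_at_least {T : choiceType} k (S : set T) :
  infinite_set S -> at_least k S.
Proof. by move=> /(@infinite_set_fset _ _ k)[s sS ks]; exists s. Qed.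

(** The loss [N] is the length of a list of [D]; being independent of [S], it serves for all earlier
    stages at once. *)
Lemma at_least_setD {T : eqType} (D : set T) : finite_set D ->
  exists N, forall k S, at_least (k + N) S -> at_least k (S `\` D).
Proof.
move=> /finite_seqP[d ->]; exists (size d) => k S [s [su sk sS]].
exists [seq x <- s | x \notin d]; split; first exact: filter_uniq.
  rewrite -(leq_add2r (size d)); apply: (leq_trans sk).
  rewrite -(count_predC (mem d) s) addnC leq_add ?size_filter//.
  rewrite -size_filter; apply: uniq_leq_size; [exact: filter_uniq|].
  by move=> x; rewrite mem_filter => /andP[].
move=> x /=; rewrite mem_filter => /andP[xd xs]; split; first exact: sS.
exact/negP.
Qed.

Lemma almost_subsetW (S S' : set nat) : S `<=` S' -> S `<=*` S'.
Proof. by move=> SS'; apply: (@sub_finite_set _ _ set0) => // x [/SS']. Qed.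

Lemma almost_subset_trans (S1 S2 S3 : set nat) :
  S1 `<=*` S2 -> S2 `<=*` S3 -> S1 `<=*` S3.
Proof.
move=> S12 S23; have : finite_set ((S1 `\` S2) `|` (S2 `\` S3)).
  by rewrite finite_setU.
apply: sub_finite_set => x [x1 x3].
by have [x2|x2] := pselect (S2 x); [right|left].
Qed.

Lemma almost_subsetI (S S1 S2 : set nat) :
  S `<=*` S1 -> S `<=*` S2 -> S `<=*` (S1 `&` S2).
Proof. by move=> SS1 SS2; rewrite /almost_subset setDIr finite_setU. Qed.

Lemma infinite_almost (S S' C : set nat) :
  S `<=*` S' -> infinite_set (S `&` C) -> infinite_set (S' `&` C).
Proof.
move=> SS' /infinite_setD/(_ SS'); apply: sub_infinite_set => x [[Sx Cx] nx].
by split=> //; apply: contrapT => S'x; apply: nx.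
Qed.

(* The first component of a cell is its column; a column splits into infinitely
   many infinite cells, so that A_a can meet the column infinitely often and
   still take only one point from each cell. *)
Definition cell (x : nat) : nat * nat :=
  (odflt ((0, 0), 0) (choice.unpickle x : option (nat * nat * nat))).1.

Lemma cell_infinite p : infinite_set (cell @^-1` [set p]).
Proof.
move=> pfin; apply: infinite_nat.
have iinj : {in [set: nat] &, injective (fun i => choice.pickle (p, i))}.
  by move=> i j _ _ /(pcan_inj choice.pickleK)[].
rewrite -(eq_finite_set (inj_card_eq iinj)).
apply: sub_finite_set pfin => _ [i _ <-].
by rewrite /cell /= choice.pickleK.
Qed.

Definition column (n : nat) : set nat := [set x | (cell x).1 = n].

(** * Stages of the recursion and their tails *)

Record stage := Stage { SA : set nat; SB : set nat; SZ : set nat }.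

(* [SZ s] plays the role of N \ (X_a ∪ Y_a), where a is the stage of [s]. *)
Record extends (e : omega1 -> omega1 -> nat) (F : omega1 -> stage)
    (a : omega1) (s : stage) : Prop := Extends {
  disjAB : SA s `&` SB s = set0;
  disjXZ : (SA s `|` SB s) `&` SZ s = set0;
  almost_le : forall b : omega1, (b < a)%O ->
    (SA s `|` SB s `|` SZ s) `<=*` SZ (F b);
  infA : forall n, infinite_set (SA s `&` column n);
  infZ : forall p, infinite_set (SZ s `&` cell @^-1` [set p]);
  largeZ : forall k, finite_set [set b : omega1 | (b < a)%O /\
    ~ at_least k (SA (F b) `&` SZ s `&` column (e a b))];
  lusin : forall k, finite_set [set b : omega1 | (b < a)%O /\
    ~ exists l, (k < l)%N /\ (SA (F b) `&` SB s) l] }.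

(** This is W_j. If [e] is injective below [a], at most [j] sets are intersected. *)
Definition tail (e : omega1 -> nat) (F : omega1 -> stage) (a : omega1) (j : nat)
    : set nat :=
  [set x | forall c : omega1, (c < a)%O -> (e c < j)%N -> SZ (F c) x].

Lemma tail_anti e F a i j : (i <= j)%N -> tail e F a j `<=` tail e F a i.
Proof. by move=> ij x xj c ca ci; apply: xj => //; apply: leq_trans ij. Qed.

(** By injectivity each increase of [j] adds at most one set to the intersection. The set with the
    largest index is almost contained in all the others, so it serves as [SZ (F d)]. *)
Lemma tail_base e F (a : omega1) j :
  {in [set b : omega1 | (b < a)%O] &, injective e} ->
  (forall b c : omega1, (b < a)%O -> (c < b)%O -> SZ (F b) `<=*` SZ (F c)) ->
  tail e F a j = setT \/ exists2 d : omega1, (d < a)%O & SZ (F d) `<=*` tail e F a j.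
Proof.
move=> einj Zle; elim: j => [|j IH]; first by left; apply/seteqP; split.
have [[c ca ec]|nj] := pselect (exists2 c : omega1, (c < a)%O & e c = j); last first.
  suff -> : tail e F a j.+1 = tail e F a j by [].
  apply/seteqP; split=> [|x xj b ba]; first exact: tail_anti.
  rewrite ltnS leq_eqVlt => /orP[/eqP eb|]; last exact: xj.
  by case: nj; exists b.
have tailE : tail e F a j.+1 = tail e F a j `&` SZ (F c).
  apply/seteqP; split=> [x xj|x [xj xc] b ba].
    by split; [apply: tail_anti xj|apply: xj; rewrite ?ec].
  rewrite ltnS leq_eqVlt => /orP[/eqP eb|]; last exact: xj.
  by rewrite (einj b c) ?inE ?eb.
right; rewrite tailE; case: IH => [->|[d da Zd]].
  by exists c => //; apply: almost_subsetW => x; split.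
have [cd|dc|cd] := ltgtP c d.
- by exists d => //; apply: almost_subsetI => //; apply: Zle.
- exists c => //; apply: almost_subsetI; last exact: almost_subsetW.
  by apply: almost_subset_trans Zd; apply: Zle.
- exists c => //; apply: almost_subsetI; last exact: almost_subsetW.
  by rewrite cd.
Qed.

Lemma tail_infinite e F (a : omega1) j p :
  {in [set b : omega1 | (b < a)%O] &, injective (e a)} ->
  (forall b : omega1, (b < a)%O -> extends e F b (F b)) ->
  infinite_set (tail (e a) F a j `&` cell @^-1` [set p]).
Proof.
move=> einj Fext.
have [|->|[d da Zd]] := @tail_base (e a) F a j einj.
- move=> b c ba cb; apply: almost_subset_trans (almost_le _ _ _ _ (Fext b ba) _ cb).
  by apply: almost_subsetW => x; right.
- by rewrite setTI; apply: cell_infinite.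
- exact: infinite_almost Zd (infZ _ _ _ _ (Fext d da) p).
Qed.

(** Let [d] come from [tail_base]. For [b < d], [largeZ] at [d] applies with [k + N] to absorb the
    finite error, and coherence turns column [e d b] into [e a b]. For [d < b], [SA (F b)] is itself
    almost contained in the tail. *)
Lemma tail_large e F (a : omega1) j k :
  {in [set b : omega1 | (b < a)%O] &, injective (e a)} ->
  (forall c : omega1, (c < a)%O ->
    finite_set [set b : omega1 | (b < c)%O /\ e c b <> e a b]) ->
  (forall b : omega1, (b < a)%O -> extends e F b (F b)) ->
  finite_set [set b : omega1 | (b < a)%O /\
    ~ at_least k (SA (F b) `&` tail (e a) F a j `&` column (e a b))].
Proof.
move=> einj ecoh Fext.
have [|tailE|[d da Zd]] := @tail_base (e a) F a j einj.
- move=> b c ba cb; apply: almost_subset_trans (almost_le _ _ _ _ (Fext b ba) _ cb).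
  by apply: almost_subsetW => x; right.
- apply: (@sub_finite_set _ _ set0) => // b [ba]; apply.
  rewrite tailE setIT; apply: infinite_at_least.
  exact: (infA _ _ _ _ (Fext b ba)).
have [N NP] := at_least_setD _ Zd.
have fin : finite_set ([set d] `|`
    ([set b : omega1 | (b < d)%O /\ e d b <> e a b] `|`
     [set b : omega1 | (b < d)%O /\
       ~ at_least (k + N) (SA (F b) `&` SZ (F d) `&` column (e d b))])).
  rewrite !finite_setU; split=> //; split; first exact: ecoh.
  exact: (largeZ _ _ _ _ (Fext d da)).
apply: sub_finite_set fin => b [ba nb].
have [bd|db|->] := ltgtP b d; last by left.
- right; have [eb|eb] := pselect (e d b = e a b); last by left.
  right; split=> //; rewrite eb => /NP lb; apply: nb; apply: at_least_sub lb.
  move=> x [[[Ax Zx] cx] nx]; split=> //; split=> //.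
  by apply: contrapT => ntx; apply: nx.
- case: nb; apply: infinite_at_least.
  have := infA _ _ _ _ (Fext b ba) (e a b).
  have /(infinite_almost _ _ (SA (F b) `&` column (e a b))) :
      SA (F b) `<=*` tail (e a) F a j.
    apply: almost_subset_trans Zd.
    apply: almost_subset_trans (almost_le _ _ _ _ (Fext b ba) _ db).
    by apply: almost_subsetW => x; left; left.
  rewrite setIA setIid => inf /inf; apply: sub_infinite_set.
  by move=> x [? []].
Qed.

(** * Construction of the next stage *)

(** The size of a piece is also the index of its tail. As sizes tend to infinity, the union of the
    pieces is almost contained in every tail. *)
Lemma pick_pieces e F (a : omega1) :
  {in [set b : omega1 | (b < a)%O] &, injective (e a)} ->
  (forall c : omega1, (c < a)%O ->
    finite_set [set b : omega1 | (b < c)%O /\ e c b <> e a b]) ->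
  (forall b : omega1, (b < a)%O -> extends e F b (F b)) ->
  exists s : omega1 -> seq nat,
    [/\ forall b, uniq (s b),
        forall b, [set` s b] `<=`
          SA (F b) `&` tail (e a) F a (size (s b)) `&` column (e a b) &
        forall k, finite_set [set b : omega1 | (b < a)%O /\ (size (s b) < k)%N]].
Proof.
move=> einj ecoh Fext.
pose S b j := SA (F b) `&` tail (e a) F a j `&` column (e a b).
have [s sP] : {s : omega1 -> seq nat & forall b, [/\ uniq (s b),
    [set` s b] `<=` S b (size (s b)) &
    forall j, (j <= e a b)%N -> at_least j (S b j) -> (j <= size (s b))%N]}.
  apply: (@choice _ _ (fun b s => [/\ uniq s, [set` s] `<=` S b (size s) &
    forall j, (j <= e a b)%N -> at_least j (S b j) -> (j <= size s)%N])) => b.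
  (* The bound [e a b] ensures that a largest [j] exists; by injectivity it is below a given [k] for
     finitely many [b] only. *)
  pose Q j := (j <= e a b)%N && `[< at_least j (S b j) >].
  have Q0 : exists j, Q j by exists 0%N; apply/asboolP; exists [::].
  have Qle j : Q j -> (j <= e a b)%N by case/andP.
  case: (ex_maxnP Q0 Qle) => j /andP[je /asboolP[s [su sj sS]]] jmax.
  exists (take j s); rewrite size_takel//; split; first exact: take_uniq.
    by move=> x /mem_take /sS.
  by move=> i ie ati; apply: jmax; rewrite /Q ie; apply/asboolP.
exists s; split=> [b|b|k]; [by have [] := sP b|by have [] := sP b|].
have fin : finite_set ([set b : omega1 | (b < a)%O /\ (e a b < k)%N] `|`
    [set b : omega1 | (b < a)%O /\ ~ at_least k (S b k)]).
  rewrite finite_setU; split; last exact: tail_large.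
  exact: finite_preimage_in einj (finite_II k).
apply: sub_finite_set fin => b [ba sk]; have [_ _ smax] := sP b.
have [ek|ke] := ltnP (e a b) k; [by left|right; split=> // atk].
by move: sk; rewrite ltnNge smax.
Qed.

Lemma extension_exists e F (a : omega1) :
  {in [set b : omega1 | (b < a)%O] &, injective (e a)} ->
  (forall c : omega1, (c < a)%O ->
    finite_set [set b : omega1 | (b < c)%O /\ e c b <> e a b]) ->
  (forall b : omega1, (b < a)%O -> extends e F b (F b)) ->
  exists s, extends e F a s.
Proof.
move=> einj ecoh Fext.
have [s [su sS slarge]] := pick_pieces _ _ _ einj ecoh Fext.
(* Only finitely many [t] have coordinate sum below [j], so [range y] is almost contained in every
   tail. The condition [t.2 < y t] makes it infinite in each cell. *)
have [y yP] : {y : nat * nat * nat -> nat & forall t,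
    [/\ tail (e a) F a (t.1.1 + t.1.2 + t.2) (y t), cell (y t) = t.1 & (t.2 < y t)%N]}.
  apply: (@choice _ _ (fun t y => [/\ tail (e a) F a (t.1.1 + t.1.2 + t.2) y,
    cell y = t.1 & (t.2 < y)%N])) => t.
  have /infinite_natP/(_ t.2)[z [tz cz] lz] :=
    tail_infinite e F a (t.1.1 + t.1.2 + t.2) t.1 einj Fext.
  by exists z.
pose T := [set x | exists2 b : omega1, (b < a)%O & x \in s b].
pose P := [set x | exists2 b : omega1, (b < a)%O & ohead (s b) = Some x].
(* [P], [R] and [Z] will be B_a, A_a and Z_a. *)
pose R := (range (fun p => y (p, 0))) `\` T.
pose Z := (T `|` range y) `\` (P `|` R).
have PT : P `<=` T.
  by move=> x [b ba]; case sb: (s b) => [|z l] //= [<-]; exists b; rewrite ?sb ?mem_head.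
have Tcol b x : (b < a)%O -> T x -> column (e a b) x -> x \in s b.
  move=> ba [c ca xc] cx; have [_ cx'] := sS c x xc.
  rewrite -(einj c b) ?inE//; first by rewrite -cx -cx'.
(* Distinct pieces lie in distinct columns, so a column meets at most one piece. *)
have Tfin n : finite_set (T `&` column n).
  have [[b ba eb]|nb] := pselect (exists2 b : omega1, (b < a)%O & e a b = n).
    apply: sub_finite_set (finite_seq (s b)) => x [Tx cx] /=.
    by apply: Tcol => //; rewrite eb.
  apply: (@sub_finite_set _ _ set0) => // x [[b ba xb] cx]; apply: nb.
  by exists b => //; have [_ <-] := sS b x xb.
have almostT j : T `|` range y `<=*` tail (e a) F a j.
  have fin : finite_set ((\bigcup_(b in [set b : omega1 | (b < a)%O /\ (size (s b) < j)%N])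
      [set` s b]) `|` y @` ((`I_j `*` `I_j) `*` `I_j)).
    rewrite finite_setU; split; first by apply: bigcup_finite.
    by apply: finite_image; do 2?apply: finite_setX.
  apply: sub_finite_set fin => x [[[b ba xb]|[t _ <-]] nx].
    left; exists b => //; split=> //; rewrite ltnNge; apply/negP => js; apply: nx.
    by have [[_ tx] _] := sS b x xb; apply: tail_anti tx.
  right; exists t => //; have [ty _ _] := yP t.
  have : (t.1.1 + t.1.2 + t.2 < j)%N.
    by rewrite ltnNge; apply/negP => js; apply: nx; apply: tail_anti ty.
  move=> tj; split; first split; apply: leq_ltn_trans tj => /=.
  - by rewrite -addnA leq_addr.
  - by rewrite addnAC leq_addl.
  - by rewrite leq_addl.
exists (Stage R P Z); split=> /=.
- by apply/seteqP; split=> // x [[_ nTx] /PT].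
- by apply/seteqP; split=> // x [RPx [_ nPR]]; apply: nPR; rewrite setUC.
- move=> b ba; apply: (@almost_subset_trans _ (T `|` range y)).
    apply: almost_subsetW => x [[[[p _ <-] _]|/PT Tx]|[]//]; last by left.
    by right; exists (p, 0%N).
  (* The successor is needed because [tail] at [j] involves only values strictly below [j]. *)
  apply: almost_subset_trans (almostT (e a b).+1) _.
  by apply: almost_subsetW => x /(_ b ba); apply.
- move=> n.
  have yinj : {in [set: nat] &, injective (fun m => y ((n, m), 0))}.
    move=> i j _ _ yij; have [_ ci _] := yP ((n, i), 0).
    by have [_ cj _] := yP ((n, j), 0); move: cj; rewrite -yij ci => -[].
  have yinf : infinite_set (range (fun m => y ((n, m), 0))).
    by rewrite (eq_finite_set (inj_card_eq yinj)); apply: infinite_nat.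
  apply: sub_infinite_set (infinite_setD yinf (Tfin n)) => x [[m _ <-] nT].
  have [_ cm _] := yP ((n, m), 0).
  have cn : column n (y ((n, m), 0)) by rewrite /column /= cm.
  by split=> //; split; [exists (n, m)|move=> Tx; apply: nT].
- move=> p.
  have yinf : infinite_set (range (fun i => y (p, i))).
    apply/infinite_natP => i; exists (y (p, i)); first by exists i.
    by have [] := yP (p, i).
  (* In cell [p], [R] contains at most [y (p, 0)], and [P] lies in [T]. *)
  have Dfin : finite_set ((T `&` column p.1) `|` [set y (p, 0)]).
    by rewrite finite_setU.
  apply: sub_infinite_set (infinite_setD yinf Dfin) => x [[i _ <-] nD].
  have [_ ci _] := yP (p, i); split=> //; split; first by right; exists (p, i).
  move=> [/PT Tx|[[q _ yq] _]]; apply: nD.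
    by left; split=> //; rewrite /column /= ci.
  right; have [_ cq _] := yP (q, 0).
  by rewrite -yq; move: ci; rewrite -yq cq /= => ->.
(* A piece of size [k.+1] keeps [k] points once its head has gone to [P]. *)
- move=> k; apply: sub_finite_set (slarge k.+1) => b [ba nb]; split=> //.
  rewrite ltnNge; apply/negP => ks; apply: nb; exists (behead (s b)); split.
  + by have := su b; case: (s b) => //= x l /andP[].
  + by rewrite size_behead -ltnS prednK //; apply: leq_trans ks.
  + move=> x xb; have xs : x \in s b by apply: mem_behead.
    have Tx : T x by exists b.
    have [[Ax _] cx] := sS b x xs; split=> //; split=> //; split; first by left.
    move=> [[c ca hc]|[]//].
    have xc : x \in s c by move: hc; case: (s c) => //= z l [->]; rewrite mem_head.
    have [_ cx'] := sS c x xc.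
    have bc : b = c by apply: einj; rewrite ?inE// -cx -cx'.
    move: hc xb (su b); rewrite -bc; case: (s b) => //= z l [->] /= xl.
    by rewrite xl.
- move=> k.
  (* The witness is the head of [s b]. It can be at most [k] only if column [e a b] contains a
     number up to [k], hence for finitely many [b]. *)
  have fin : finite_set ([set b : omega1 | (b < a)%O /\ (size (s b) < 1)%N] `|`
      [set b : omega1 | (b < a)%O /\ ((fun x => (cell x).1) @` `I_k.+1) (e a b)]).
    rewrite finite_setU; split; first exact: slarge.
    exact: finite_preimage_in einj (finite_image (fun x => (cell x).1) (finite_II k.+1)).
  apply: sub_finite_set fin => b [ba nb].
  case sb : (s b) => [|x l]; [by left; rewrite /= sb|right; split=> //].
  have xb : x \in s b by rewrite sb mem_head.
  have [[Ax _] cx] := sS b x xb; exists x => //=; rewrite ltnS leqNgt.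
  apply/negP => kx; apply: nb; exists x; split=> //; split=> //.
  by exists b => //; rewrite sb.
Qed.

(** * The families obtained from the recursion *)

Theorem theorem3p2 :
  exists X Y A B : omega1 -> set nat,
    (forall alpha : omega1,
       [/\ X alpha = A alpha `|` B alpha,
           infinite_set (X alpha) &
           A alpha `&` B alpha = set0]) /\
    (forall alpha beta : omega1, (beta < alpha)%O ->
       finite_set (X beta `&` X alpha)) /\
    (forall alpha beta : omega1, (beta < alpha)%O ->
       Y beta `<=*` Y alpha) /\
    (forall alpha beta : omega1, (beta < alpha)%O ->
       X beta `<=*` Y alpha) /\
    (forall alpha : omega1, X alpha `&` Y alpha = set0) /\
    (forall (alpha : omega1) (k : nat),
       finite_set [set beta : omega1 | (beta < alpha)%O /\
         ~ exists l : nat, (k < l)%N /\ (A beta `&` B alpha) l]).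
Proof.
have [e [einj ecoh]] := coherent_injective.
have [|a F IH|F FP] := omega1_rec (Stage set0 set0 set0) (fun a F s => extends e F a s).
- move=> a F G s FG [? ? le ? ? large lus]; split=> //.
  + by move=> b ba; rewrite -FG//; apply: le.
  + move=> k; apply: sub_finite_set (large k) => b [ba nb].
    by split=> //; rewrite FG.
  + move=> k; apply: sub_finite_set (lus k) => b [ba nb].
    by split=> //; rewrite FG.
- exact: extension_exists (einj a) (ecoh a) IH.
pose X a := SA (F a) `|` SB (F a).
pose Y a := ~` (X a `|` SZ (F a)).
have XZ a x : X a x -> ~ SZ (F a) x.
  by move=> Xx Zx; have : (X a `&` SZ (F a)) x by []; rewrite (disjXZ _ _ _ _ (FP a)).
exists X, Y, (SA \o F), (SB \o F); repeat split.
- apply: sub_infinite_set (infA _ _ _ _ (FP alpha) 0%N).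
  by move=> x [Ax _]; left.
- exact: disjAB _ _ _ _ (FP alpha).
(* The next three clauses share one reason: the complement of [Y a] is almost contained in
   [SZ (F b)], which is disjoint from [X b] and [Y b]. *)
- move=> a b ba; apply: sub_finite_set (almost_le _ _ _ _ (FP a) b ba).
  by move=> x [Xb Xa]; split; [left|apply: XZ].
- move=> a b ba; apply: sub_finite_set (almost_le _ _ _ _ (FP a) b ba).
  by move=> x [Yb /contrapT Xa]; split=> // Zx; apply: Yb; right.
- move=> a b ba; apply: sub_finite_set (almost_le _ _ _ _ (FP a) b ba).
  by move=> x [Xb /contrapT Xa]; split=> //; apply: XZ.
- by move=> a; apply/seteqP; split=> // x [Xx]; apply; left.
- by move=> a; apply: (lusin _ _ _ _ (FP a)).
Qed.
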